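(* There is a binary sequence $S\in\{0,1\}^\omega$ such that $$\mathrm{aDim}_{\mathrm{FS}}^{(2)}(S)<\mathrm{odim}_{\mathrm{FS}}^{\mathrm{MH}}(S)-0.3,$$ where $\mathrm{aDim}_{\mathrm{FS}}^{(2)}(S)$ is the adaptive two-head finite-state strong predimension of $S$ and $\mathrm{odim}_{\mathrm{FS}}^{\mathrm{MH}}(S)$ is the oblivious multi-head finite-state dimension of $S$.
   Context: $\mathbb{N}=\{0,1,2,\ldots\}$. For $S\in\{0,1\}^\omega$ and $n\in\mathbb{N}$, $S[n]$ is the bit at index $n$ and $S[0:n]=S[0]\cdots S[n-1]$. **Gamblers.** For $h\ge 1$, an (adaptive) $h$-head finite-state gambler ($h$-FSG) over $\{0,1\}$ is a tuple $G=(Q,\{0,1\},\delta,\beta,q_0,c_0)$ with $Q$ a finite state set, transition function $\delta:Q\times\{0,1\}^h\to Q\times\{0,1\}^{h-1}$, betting function $\beta:Q\to\Delta_{\mathbb{Q}}(\{0,1\})$ (where $\Delta_{\mathbb{Q}}(\{0,1\})$ is the set of rational-valued probability distributions on $\{0,1\}$), initial state $q_0\in Q$, and initial capital $c_0\in[0,\infty)$. Run on $S\in\{0,1\}^\omega$, it has states $q(S[0:n])$ and head positions $\pi_i(S[0:n])$, $1\le i\le h$, defined by $q(S[0:0])=q_0$, $\pi_i(S[0:0])=0$, and, if $$\delta\big(q(S[0:n]),(S[\pi_1(S[0:n])],\ldots,S[\pi_h(S[0:n])])\big)=(q',(r_1,\ldots,r_{h-1}))$$ and $r_h=1$, then $q(S[0:n+1])=q'$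 and $\pi_i(S[0:n+1])=\pi_i(S[0:n])+r_i$ for all $i$. (So head $h$, the leading head, is always at position $n$ at step $n$; heads $1,\ldots,h-1$ are trailing heads.) $G$ is oblivious if $\pi_i(R[0:n])=\pi_i(S[0:n])$ for all $R,S\in\{0,1\}^\omega$, $n\in\mathbb{N}$, $1\le i\le h$. **Capital.** The martingale $d_G$ of $G$ is given by $d_G(S[0:0])=c_0$ and $d_G(S[0:n+1])=2\,\beta(q(S[0:n]))(S[n])\,d_G(S[0:n])$. Its $s$-gale is $d_G^{(s)}(S[0:n])=2^{(s-1)n}d_G(S[0:n])$. It succeeds on $S$ if $\limsup_{n\to\infty}d_G^{(s)}(S[0:n])=\infty$ and strongly succeeds on $S$ if $\liminf_{n\to\infty}d_G^{(s)}(S[0:n])=\infty$. **Dimensions.** With $s$ ranging over $[0,\infty)$, $$\mathrm{aDim}_{\mathrm{FS}}^{(h)}(S)=\inf\{s:\exists\ h\text{-FSG }G\text{ such that }d_G^{(s)}\text{ strongly succeeds on }S\},$$ $$\mathrm{odim}_{\mathrm{FS}}^{(h)}(S)=\inf\{s:\exists\text{ oblivious }h\text{-FSG }G\text{ such that }d_G^{(s)}\text{ succeeds on }S\},$$ and $\mathrm{odim}_{\mathrm{FS}}^{\mathrm{MH}}(S)=\liminf_{h\to\infty}\mathrm{odim}_{\mathrm{FS}}^{(h)}(S)$ (each $\mathrm{odim}_{\mathrm{FS}}^{(h)}(S)$ is non-increasing in $h$). *)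

(* Defs.v *)
From HB Require Import structures.
From mathcomp Require Import all_boot all_order all_algebra.
From mathcomp Require Import all_classical all_reals all_analysis.

Set Implicit Arguments.
Unset Strict Implicit.
Unset Printing Implicit Defensive.

Import Order.TTheory GRing.Theory Num.Theory.
Import numFieldNormedType.Exports.

Local Open Scope classical_set_scope.
Local Open Scope ring_scope.

(* An adaptive h-head finite-state gambler over {0,1}; a bit 1 is [true].
   The notion is meant for h >= 1. The degenerate type [fsg R 0] only enters
   through the term h = 0 of the limit in [odim_FS_MH], which is immaterial. *)
Record fsg (R : realType) (h : nat) := Fsg {
  fsg_state : finType ;
  fsg_delta : fsg_state -> h.-tuple bool -> fsg_state * h.-1.-tuple bool ;
  fsg_beta : fsg_state -> bool -> rat ;
  fsg_beta_ge0 : forall q b, 0 <= fsg_beta q b ;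
  fsg_beta_sum1 : forall q, \sum_(b : bool) fsg_beta q b = 1 ;
  fsg_q0 : fsg_state ;
  fsg_c0 : R ;
  fsg_c0_ge0 : 0 <= fsg_c0
}.

Section gambler.
Context {R : realType} {h : nat}.
Implicit Types (G : fsg R h) (S : nat -> bool) (n : nat) (s : R).

(* Heads are numbered from 0, so the leading head is the one of index h.-1.
   The tuple r returned by the transition function has size h.-1, hence the
   default value [true] of [nth] gives the leading head its constant move 1. *)
Definition fsg_step G S (c : fsg_state G * ('I_h -> nat)) :
    fsg_state G * ('I_h -> nat) :=
  let: (q', r) := fsg_delta c.1 [tuple S (c.2 i) | i < h] in
  (q', fun i => (c.2 i + nth true r i)%N).

(* [fsg_run G S n] is the configuration of G after n steps: it depends only on
   the prefix S[0:n], no head being beyond position k at step k. *)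
Definition fsg_run G S n : fsg_state G * ('I_h -> nat) :=
  iter n (@fsg_step G S) (fsg_q0 G, fun=> 0%N).

Definition state_at G S n : fsg_state G := (fsg_run G S n).1.

Definition head_at G S n (i : 'I_h) : nat := (fsg_run G S n).2 i.

Definition oblivious G : Prop :=
  forall S S' n (i : 'I_h), head_at G S n i = head_at G S' n i.

Fixpoint capital G S n : R :=
  if n is m.+1 then
    2 * ratr (fsg_beta (state_at G S m) (S m)) * capital G S m
  else fsg_c0 G.

Definition sgale G s S n : R := 2 `^ ((s - 1) * n%:R) * capital G S n.

Definition succeeds G s S : Prop :=
  limn_esup (fun n => (sgale G s S n)%:E) = +oo%E.

Definition strongly_succeeds G s S : Prop :=
  limn_einf (fun n => (sgale G s S n)%:E) = +oo%E.

End gambler.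

Definition aDim_FS (R : realType) (h : nat) (S : nat -> bool) : \bar R :=
  ereal_inf [set s%:E | s in
    [set s : R | 0 <= s /\ exists G : fsg R h, strongly_succeeds G s S]].

Definition odim_FS (R : realType) (h : nat) (S : nat -> bool) : \bar R :=
  ereal_inf [set s%:E | s in
    [set s : R | 0 <= s /\
                 exists G : fsg R h, oblivious G /\ succeeds G s S]].

Definition odim_FS_MH (R : realType) (S : nat -> bool) : \bar R :=
  limn_einf (fun h => odim_FS R h S).

(* Main.v *)
(** The sequence is a succession of stages. Stage j consists of j groups of 20
    bits, each made of a flag and 19 fresh bits, followed by a copy of those
    groups, the flags telling the two halves apart. An adaptive trailing head
    rests during the first group of each stage, which raises its lag by exactly
    the 20 bits needed; it then predicts all of the 19 j non-flag bits of the
    copy, out of the 40 j bits of the stage, hence aDim <= 0.53.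

    The trailing heads of an oblivious gambler move in an eventually periodic
    way, so each of them either keeps a bounded lag or falls behind linearly. As
    stage j is long but short compared with the past, for large j no head is in
    the fresh half of stage j while the last 19 j bits of that stage are bet
    upon. Each half taken separately, from a given state, is then a fair game on
    the fresh word except for the flags, so the gain averaged over all words is
    at most 4^j. Since there are countably many machines, the words can be chosen
    one after the other so that every machine gains only a polynomial factor more
    than this average on almost all stages. This leaves a gain of at most 2^(6j)
    on the 40 j bits of stage j, hence odim >= 0.85 for any number of heads. *)

Require Import Defs.
From mathcomp Require Import all_boot all_order all_algebra.
From mathcomp Require Import all_classical all_reals all_analysis.
From mathcomp Require Import zify ring lra.

Set Implicit Arguments.
Unset Strict Implicit.
Unset Printing Implicit Defensive.

Import Order.TTheory GRing.Theory Num.Theory.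

Local Open Scope ring_scope.

(** * Layout of the stages *)

Definition start j := (40 * 'C(j, 2))%N.

Lemma startS j : start j.+1 = (start j + 40 * j)%N.
Proof. by rewrite /start binS bin1 mulnDr addnC. Qed.

Lemma double_bin2 j : ('C(j, 2) + 'C(j, 2) + j = j * j)%N.
Proof. by elim: j => // j IH; rewrite binS bin1; lia. Qed.

Lemma start_homo : {homo start : i j / (i <= j)%N}.
Proof. by move=> i j ij; rewrite leq_mul2l /= leq_bin2l. Qed.

Lemma ltn_start n : (n < start n.+2)%N.
Proof. have := double_bin2 n.+2; rewrite /start; lia. Qed.

(* One index too many, so that [inord] applies also when j = 0. *)
Definition word j : finType := {ffun 'I_(20 * j).+1 -> bool}.

(* Groups of 20 bits, the first one being the flag: 1 in the fresh half of the
   stage, 0 in the replica half. The replica lags by one bit more than 20 j,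
   because a gambler bets on a bit knowing only what its heads read one step
   earlier. *)
Definition fresh j (x : word j) t := (20 %| t)%N || x (inord t).

Definition replica j (x : word j) t := ~~ (20 %| t)%N && fresh x t.-1.

(** Values from [start j.+1] on are junk, to be overwritten by the next stage. *)
Definition stage j (x : word j) (S : nat -> bool) u :=
  if (u < start j)%N then S u
  else if (u < start j + 20 * j)%N then fresh x (u - start j)
  else replica x (u - (start j + 20 * j)).

Definition mask j (S : nat -> bool) u :=
  ~~ (start j <= u < start j + 20 * j)%N && S u.

Definition flip j (i : nat) (x : word j) : word j :=
  [ffun k => (k == inord i) (+) x k].

Lemma flipK j i : involutive (@flip j i).
Proof. by move=> x; apply/ffunP => k; rewrite !ffunE addbA addbb. Qed.

Lemma fresh_flip_lt j (x : word j) i t :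
  (t < i)%N -> (i <= 20 * j)%N -> fresh (flip i x) t = fresh x t.
Proof.
move=> ti ij; rewrite /fresh ffunE -val_eqE /= !inordK; last by lia.
  by rewrite ltn_eqF.
by lia.
Qed.

Lemma fresh_flip_eq j (x : word j) i :
  ~~ (20 %| i)%N -> fresh (flip i x) i = ~~ fresh x i.
Proof. by move=> /negPf h; rewrite /fresh h /= ffunE eqxx. Qed.

(** Pigeonhole on the first [#|T| + 1] iterates. *)
Lemma iter_eventually_periodic (T : finType) (f : T -> T) x :
  exists a p, (0 < p)%N /\
    forall t m, (a <= t)%N -> iter (t + m * p) f x = iter t f x.
Proof.
have /injectivePn[i [k ik eik]] :
    ~~ injectiveb (fun i : 'I_#|T|.+1 => iter i f x).
  by apply/negP => /injectiveP /leq_card; rewrite card_ord ltnn.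
wlog lt_ik : i k ik eik / (i < k)%N.
  move=> wl; move: (ik); rewrite -val_eqE neq_ltn => /orP[|] lt.
    exact: (wl i k).
  by apply: (wl k i) => //; rewrite eq_sym.
exists i, (k - i)%N; split=> [|t m it]; first by rewrite subn_gt0.
elim: m => [|m IH]; first by rewrite addn0.
have -> : (t + m.+1 * (k - i) = (t - i + m * (k - i)) + k)%N by lia.
by rewrite iterD -eik -iterD -IH; congr iter; lia.
Qed.

(** * Machines with predetermined head positions, and their average gain *)

Section Machine.
Context {R : realType} {Q : finType} {h : nat}.
Variables (delta : Q -> h.-tuple bool -> Q * h.-1.-tuple bool).
Variables (beta : Q -> bool -> rat) (q0 : Q).

(* The head positions of an oblivious machine, read off its run on 000... *)
Definition blank_step (c : Q * ('I_h -> nat)) : Q * ('I_h -> nat) :=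
  let: (q, r) := delta c.1 [tuple false | i < h] in
  (q, fun i => (c.2 i + nth true r i)%N).

Definition pos t : 'I_h -> nat := (iter t blank_step (q0, fun=> 0%N)).2.

Fixpoint state_from T q (S : nat -> bool) d : Q :=
  if d is e.+1 then
    (delta (state_from T q S e) [tuple S (pos (T + e) i) | i < h]).1
  else q.

Fixpoint gain T q (S : nat -> bool) d : R :=
  if d is e.+1 then
    2 * ratr (beta (state_from T q S e) (S (T + e)%N)) * gain T q S e
  else 1.

Lemma posS t i :
  pos t.+1 i = (pos t i +
    nth true (delta (iter t blank_step (q0, fun=> 0%N)).1
                    [tuple false | i < h]).2 i)%N.
Proof. by rewrite /pos iterS {1}/blank_step; case: (delta _ _). Qed.

Lemma pos_le t i : (pos t i <= t)%N.
Proof. by elim: t => // t IH; rewrite posS; case: nth; lia. Qed.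

Lemma state_from_cat T q S d e :
  state_from T q S (d + e) = state_from (T + d) (state_from T q S d) S e.
Proof. by elim: e => [|e IH]; rewrite ?addn0// addnS /= IH addnA. Qed.

Lemma gain_cat T q S d e :
  gain T q S (d + e) = gain T q S d * gain (T + d) (state_from T q S d) S e.
Proof.
elim: e => [|e IH]; first by rewrite addn0 mulr1.
by rewrite addnS /= IH state_from_cat addnA [in RHS]mulrCA.
Qed.

Lemma eq_state_from T q S S' d :
  (forall t i, (T <= t < T + d)%N -> S (pos t i) = S' (pos t i)) ->
  state_from T q S d = state_from T q S' d.
Proof.
elim: d => //= d IH H; rewrite IH; last by move=> t i ht; apply: H; lia.
by congr (delta _ _).1; apply: eq_from_tnth => i; rewrite !tnth_mktuple H; lia.
Qed.

Lemma eq_gain T q S S' d :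
  (forall t, (T <= t < T + d)%N ->
    S t = S' t /\ forall i, S (pos t i) = S' (pos t i)) ->
  gain T q S d = gain T q S' d.
Proof.
elim: d => //= d IH H; rewrite IH; last by move=> t ht; apply: H; lia.
rewrite (@eq_state_from _ _ S S') => [|t i ht]; last by apply: (H t _).2; lia.
by rewrite (H (T + d)%N _).1//; lia.
Qed.

Lemma eq_gain_lt T q S S' d :
  (forall t, (t < T + d)%N -> S t = S' t) -> gain T q S d = gain T q S' d.
Proof.
move=> H; apply: eq_gain => t ht; split=> [|i]; apply: H; first by lia.
by have := pos_le t i; lia.
Qed.

Hypothesis beta_ge0 : forall q b, 0 <= beta q b.
Hypothesis beta_sum1 : forall q, \sum_(b : bool) beta q b = 1.

Lemma beta_le1 q b : beta q b <= 1.
Proof.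
by rewrite -(beta_sum1 q) (bigD1 b)//= lerDl sumr_ge0.
Qed.

Lemma gain_ge0 T q S d : 0 <= gain T q S d.
Proof.
by elim: d => //= d IH; rewrite mulr_ge0// mulr_ge0// ler0q. Qed.

Lemma gainS_le T q S d : gain T q S d.+1 <= 2 * gain T q S d.
Proof.
rewrite /= ler_wpM2r ?gain_ge0// ler_piMr// -[leRHS](rmorph1 (@ratr R)).
by rewrite ler_rat beta_le1.
Qed.

Lemma gain_le T q S d : gain T q S d <= 2 ^+ d.
Proof.
elim: d => // d IH; apply: le_trans (gainS_le _ _ _ _) _.
by rewrite exprS ler_pM2l.
Qed.

(** [F x] and [F (f x)] agree before time [T + d], so the same distribution is bet on opposite bits
    and the two factors add up to 2: the bet is fair on average. *)
Lemma sum_gain_data (I : finType) (F : I -> nat -> bool) (f : I -> I) T q d :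
  involutive f -> (forall x u, (u < T + d)%N -> F (f x) u = F x u) ->
  (forall x, F (f x) (T + d)%N = ~~ F x (T + d)%N) ->
  \sum_x gain T q (F x) d.+1 = \sum_x gain T q (F x) d.
Proof.
move=> fK Flt Feq; apply: (@mulfI _ 2) => //.
rewrite [in LHS]mulr_natl mulr2n [X in X + _](reindex_inj (can_inj fK))/=.
rewrite -big_split mulr_sumr; apply: eq_bigr => x _ /=.
rewrite (eq_gain_lt _ (Flt x)) Feq (@eq_state_from _ _ (F (f x)) (F x)); last first.
  by move=> t i ht; apply: Flt; have := pos_le t i; lia.
rewrite -mulrDl -mulrDr -rmorphD/=.
have := beta_sum1 (state_from T q (F x) d); rewrite big_bool /=.
by case: (F x _) => /= E; rewrite ?E 1?addrC ?E rmorph1 mulr1.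
Qed.

Lemma sum_gain_forced (I : finType) (F : I -> nat -> bool) T q d :
  \sum_x gain T q (F x) d.+1 <= 2 * \sum_x gain T q (F x) d.
Proof. by rewrite mulr_sumr; apply: ler_sum => x _; exact: gainS_le. Qed.

Lemma sum_gain_fresh j S q :
  \sum_(x : word j) gain (start j) q (stage x S) (20 * j)
  <= 4 ^+ j * #|word j|%:R.
Proof.
(* The exponent counts the flags among the first [d] bits; only at these can the average double. *)
suff H d : (d <= 20 * j)%N ->
    \sum_(x : word j) gain (start j) q (stage x S) d
    <= 2 ^+ ((d + 19) %/ 20) * #|word j|%:R.
  apply: le_trans (H _ (leqnn _)) _; rewrite ler_wpM2r//.
  have -> : ((20 * j + 19) %/ 20 = j)%N by lia.
  by rewrite lerXn2r ?nnegrE// ler_nat.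
elim: d => [|d IH] dj; first by rewrite /= sumr_const divn_small// mul1r.
have [d20|d20] := boolP (20 %| d)%N.
  apply: le_trans (sum_gain_forced _ _ _ _) _.
  have -> : ((d.+1 + 19) %/ 20 = ((d + 19) %/ 20).+1)%N by lia.
  by rewrite exprS -mulrA ler_pM2l// IH// ltnW.
rewrite (@sum_gain_data _ _ (flip d)); first last.
- move=> x; rewrite /stage ltnNge leq_addr /= ltn_add2l dj.
  by rewrite addKn fresh_flip_eq.
- move=> x u ud; rewrite /stage; case: ltnP => // u1.
  by case: ltnP => u2; [rewrite fresh_flip_lt//; lia | lia].
- exact: flipK.
have -> : ((d.+1 + 19) %/ 20 = (d + 19) %/ 20)%N by lia.
by rewrite IH// ltnW.
Qed.

Lemma sum_gain_replica j S q :
  \sum_(x : word j) gain (start j + 21 * j) q (mask j (stage x S)) (19 * j)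
  <= 4 ^+ j * #|word j|%:R.
Proof.
(* Counts the residues 0 and 1 modulo 20 below [t]: the replica has its own flag 0 there, then the
   copied flag 1, both predictable. *)
pose cnt t := ((t + 19) %/ 20 + (t + 18) %/ 20)%N.
suff H d : (d <= 19 * j)%N ->
    \sum_(x : word j) gain (start j + 21 * j) q (mask j (stage x S)) d
    <= 2 ^+ cnt (j + d)%N * #|word j|%:R.
  apply: le_trans (H _ (leqnn _)) _; rewrite ler_wpM2r//.
  have -> : cnt (j + 19 * j)%N = (2 * j)%N by rewrite /cnt; lia.
  by rewrite exprM expr2 -natrM.
elim: d => [|d IH] dj.
  by rewrite /= sumr_const ler_peMl// exprn_ege1// ler1n.
have IHd := IH (ltnW dj); rewrite addnS.
have [d20|d20] := ltnP ((j + d) %% 20) 2.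
  apply: le_trans (sum_gain_forced _ _ _ _) _.
  have -> : cnt (j + d).+1 = (cnt (j + d)%N).+1 by rewrite /cnt; lia.
  by rewrite exprS -mulrA ler_pM2l.
(* The replica lags by one index, and with the fresh half masked no earlier position shows this bit
   of the word. *)
rewrite (@sum_gain_data _ _ (flip (j + d).-1)); first last.
- move=> x; rewrite /mask /stage.
  rewrite /replica !ifF; try by apply/negP; lia.
  have -> : (start j + 21 * j + d - (start j + 20 * j) = j + d)%N by lia.
  have [-> ->] : (start j <= start j + 21 * j + d < start j + 20 * j)%N = false
    /\ (20 %| j + d)%N = false by split; apply/negP; lia.
  by rewrite fresh_flip_eq//; lia.
- move=> x u ud; rewrite /mask /stage; case: (ltnP u (start j)) => // u1.
  case: ltnP => //= u2; rewrite /replica; case: (boolP (20 %| _)%N) => //= u3.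
  by rewrite fresh_flip_lt//; lia.
- exact: flipK.
by have -> : cnt (j + d).+1 = cnt (j + d)%N by rewrite /cnt; lia.
Qed.

(* Summing over the starting states makes the test independent of the past of
   the machine. Masking the fresh half makes the replica as unpredictable as the
   word itself; it is harmless to a machine whose heads avoid that half. *)
Definition test j (S : nat -> bool) (x : word j) : R :=
  \sum_(q : Q) (gain (start j) q (stage x S) (20 * j) +
    gain (start j + 21 * j) q (mask j (stage x S)) (19 * j)).

Lemma sum_test j S :
  \sum_(x : word j) test S x <= (2 * #|Q|)%:R * 4 ^+ j * #|word j|%:R.
Proof.
rewrite exchange_big /=.
have -> : (2 * #|Q|)%:R * 4 ^+ j * #|word j|%:R =
    \sum_(q : Q) (4 ^+ j * #|word j|%:R + 4 ^+ j * #|word j|%:R) :> R.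
  by rewrite sumr_const -mulr_natl natrM; ring.
apply: ler_sum => q _; rewrite big_split /=.
by apply: lerD; [exact: sum_gain_fresh | exact: sum_gain_replica].
Qed.

Lemma test_ge0 j S (x : word j) : 0 <= test S x.
Proof. by apply: sumr_ge0 => q _; rewrite addr_ge0 ?gain_ge0. Qed.

(** On blank input the states are eventually periodic. A head that rests once in the periodic part
    loses a step in every period; otherwise it moves at every step from then on. *)
Lemma pos_dichotomy i :
  (exists a, forall t, (a <= t)%N -> (t <= pos t i + a)%N) \/
  (exists a p, (0 < p)%N /\ forall m, (pos (a + m * p) i + m <= a + m * p)%N).
Proof.
pose f q := (delta q [tuple false | i < h]).1.
have stE t : (iter t blank_step (q0, fun=> 0%N)).1 = iter t f q0.
  by elim: t => //= t <-; rewrite /blank_step /f; case: (delta _ _).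
pose mv t := nth true (delta (iter t f q0) [tuple false | i < h]).2 i.
have pS t : pos t.+1 i = (pos t i + mv t)%N by rewrite posS stE.
have [a [p [p0 per]]] := iter_eventually_periodic f q0.
have [[t0 [at0 mt0]]|nomv] := pselect (exists t, (a <= t)%N /\ mv t = false).
  right; exists t0, p; split => // m.
  have homo b n : (pos (b + n) i <= pos b i + n)%N.
    by elim: n => [|n IH]; rewrite ?addn0// addnS pS; case: (mv _); lia.
  elim: m => [|m IH]; first by rewrite !addn0 pos_le.
  have mvm : mv (t0 + m * p)%N = false by rewrite /mv per.
  have -> : (t0 + m.+1 * p = (t0 + m * p).+1 + p.-1)%N by lia.
  by have := homo (t0 + m * p).+1 p.-1; rewrite pS mvm; lia.
left; exists a => t at_; rewrite -(subnKC at_).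
elim: (t - a)%N => [|n IH]; first by lia.
rewrite addnS pS; case E : (mv (a + n)%N); first by lia.
by case: nomv; exists (a + n)%N; split => //; lia.
Qed.

(* A head falls behind linearly or keeps a bounded lag; either way it
   eventually misses the fresh half of the current stage. *)
Lemma pos_avoids_fresh i :
  exists j0, forall j, (j0 <= j)%N -> forall t,
    (start j + 21 * j <= t < start j.+1)%N ->
    ~~ (start j <= pos t i < start j + 20 * j)%N.
Proof.
case: (pos_dichotomy i) => [[a Ha]|[a [p [p0 Hp]]]].
  (* At least [j] steps past the fresh half, a lag of at most [a <= j] leaves the head beyond it. *)
  exists a => j aj t /andP[t1 t2]; have := Ha t; have := double_bin2 j.
  by rewrite /start in t1 t2 *; nia.
have mono b n : (pos (b + n) i <= pos b i + n)%N.
  by elim: n => [|n IH]; rewrite ?addn0// addnS posS; case: nth; lia.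
exists (a + 40 * p + 10)%N => j hj t; rewrite startS => /andP[t1 t2].
apply/negP => /andP[p1 _].
(* Since [start j] is quadratic in [j], time [a + m * p] has passed. The head has then lost at least
   the length of the stage, so it is still before [start j]. *)
pose m := (40 * j)%N.
have am : (a + m * p <= t)%N.
  by have := double_bin2 j; rewrite /start /m in t1 *; nia.
have := mono (a + m * p)%N (t - (a + m * p))%N; rewrite subnKC//.
by have := Hp m; rewrite /m in am *; lia.
Qed.

End Machine.

(** * Enumeration of the machines and choice of the words *)

Lemma gain_morph (R : realType) (Q Q' : finType) h
    (delta : Q -> h.-tuple bool -> Q * h.-1.-tuple bool)
    (delta' : Q' -> h.-tuple bool -> Q' * h.-1.-tuple bool)
    (beta : Q -> bool -> rat) (beta' : Q' -> bool -> rat) (f : Q -> Q') q0 :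
  (forall q v, delta' (f q) v = (f (delta q v).1, (delta q v).2)) ->
  (forall q b, beta' (f q) b = beta q b) ->
  forall T q S d, gain delta' beta' (f q0) T (f q) S d
    = gain delta beta q0 T q S d :> R.
Proof.
move=> Hd Hb T q S.
have itE t : let c := iter t (blank_step delta) (q0, fun=> 0%N) in
    iter t (blank_step delta') (f q0, fun=> 0%N) = (f c.1, c.2).
  elim: t => //= t ->; rewrite /blank_step /= Hd.
  by case: (delta _ _).
have posE t : pos delta' (f q0) t = pos delta q0 t by rewrite /pos itE.
have stE d : state_from delta' (f q0) T (f q) S d =
    f (state_from delta q0 T q S d).
  by elim: d => //= d ->; rewrite Hd /= posE.
by elim=> //= d ->; rewrite stE Hb.
Qed.

(* Machines with states 'I_m: up to relabelling every gambler is one of them,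
   and there are countably many. *)
Definition code : countType := {h : nat & {m : nat &
  ({ffun 'I_m * h.-tuple bool -> 'I_m * h.-1.-tuple bool} *
   {ffun 'I_m * bool -> rat} * 'I_m)%type}}.

Definition code_card (c : code) : nat := tag (tagged c).

Definition code_test {R : realType} (c : code) {j} (S : nat -> bool) :
    word j -> R :=
  let: existT h (existT m (d, b, q0)) := c in
  @test R 'I_m h (fun q v => d (q, v)) (fun q e => b (q, e)) q0 j S.

Lemma code_card_gt0 c : (0 < code_card c)%N.
Proof.
by case: c => h [m [[d b] q0]]; rewrite /code_card /=; case: q0; case: m {d b}.
Qed.

Definition encode (R : realType) h (G : fsg R h) : code :=
  existT _ h (existT _ #|fsg_state G|
    ([ffun p => let: (q', r) := fsg_delta (enum_val p.1) p.2 in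
       (enum_rank q', r)],
     [ffun p => fsg_beta (enum_val p.1) p.2],
     enum_rank (fsg_q0 G))).

Lemma code_test_encode (R : realType) h (G : fsg R h) j S (x : word j) :
  code_test (encode G) S x =
  test (@fsg_delta _ _ G) (@fsg_beta _ _ G) (fsg_q0 G) S x :> R.
Proof.
rewrite /code_test /= /test.
rewrite (reindex (@enum_rank (fsg_state G))) /=; last first.
  exact/onW_bij/enum_rank_bij.
apply: eq_bigr => q _; congr (_ + _); apply: gain_morph => [p v|p b];
  rewrite ffunE /= enum_rankK //; by case: (fsg_delta _ _).
Qed.

(** Divided by their bounds, the admissible [F i] average at most 1, so their sum averages at most
    [n]. Some [x] does not exceed this, and by nonnegativity neither does any single summand. *)
Lemma exists_below_average (R : realType) (X : finType) (x0 : X) n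
    (F : 'I_n -> X -> R) (b : 'I_n -> R) :
  (forall i, 0 < b i) ->
  exists x, forall i, (forall y, 0 <= F i y) ->
    \sum_y F i y <= b i * #|X|%:R -> F i x <= n%:R * b i.
Proof.
move=> b0; apply: contrapT => /forallNP bad.
pose P i := `[< (forall y, 0 <= F i y) /\ \sum_y F i y <= b i * #|X|%:R >].
have big x : n%:R < \sum_(i | P i) F i x / b i.
  have /existsNP[i /not_implyP[F0 /not_implyP[Fb /negP]]] := bad x.
  rewrite -ltNge => lt; have Pi : P i by apply/asboolP.
  rewrite (bigD1 i)//= ltr_wpDr//; last by rewrite ltr_pdivlMr.
  apply: sumr_ge0 => k /andP[/asboolP[Fk _] _].
  by rewrite divr_ge0// ltW.
have : \sum_(x : X) n%:R < \sum_x \sum_(i | P i) F i x / b i.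
  by apply: ltr_sum => //; apply/hasP; exists x0; rewrite ?mem_index_enum.
apply/negP; rewrite -leNgt exchange_big /= sumr_const.
apply: (@le_trans _ _ (\sum_(i | P i) #|X|%:R)).
  apply: ler_sum => i /asboolP[_ Fb].
  by rewrite -mulr_suml ler_pdivrMr// mulrC.
rewrite sumr_const -!mulrnA mulnC ler_nat leq_mul2r.
by apply/orP; right; rewrite -[leqRHS](card_ord n) max_card.
Qed.

Lemma stage_choice (P : forall j, (nat -> bool) -> word j -> Prop) :
  (forall j S, exists x, P j S x) ->
  exists S, forall j, exists S' x, P j S' x /\
    forall u, (u < start j.+1)%N -> S u = stage x S' u.
Proof.
move=> exP; pose x j S := sval (cid (exP j S)).
pose Sn := nat_rect (fun=> nat -> bool) (fun=> false)
  (fun j S => stage (x j S) S).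
have step j u : (u < start j)%N -> Sn j.+1 u = Sn j u.
  by move=> uj; rewrite /= /stage uj.
have stable j k u : (u < start j)%N -> (j <= k)%N -> Sn k u = Sn j u.
  move=> uj /subnKC <-; elim: (k - j)%N => [|i IH]; first by rewrite addn0.
  by rewrite addnS step// (leq_trans uj)// start_homo// leq_addr.
have limE j u : (u < start j)%N -> Sn u.+2 u = Sn j u.
  move=> uj; have [le|/ltnW le] := leqP j u.+2; first exact: stable.
  by rewrite (stable _ _ _ (ltn_start u) le).
(* Position [n] lies before [start n.+2], so [Sn n.+2] has its final value there. *)
exists (fun n => Sn n.+2 n) => j; exists (Sn j), (x j (Sn j)); split.
- by rewrite /x; case: cid.
- by move=> u uj; rewrite (limE _ _ uj).
Qed.

(* Only codes of index at most j constrain the word of stage j, so there are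
   finitely many constraints, and every code is eventually subject to them. *)
Definition sound (R : realType) j (S : nat -> bool) (x : word j) :=
  forall c i, (i <= j)%N -> unpickle i = Some c ->
  (forall y : word j, 0 <= code_test c S y :> R) ->
  \sum_(y : word j) code_test c S y
    <= (2 * code_card c)%:R * 4 ^+ j * #|word j|%:R :> R ->
  code_test c S x <= j.+1%:R * ((2 * code_card c)%:R * 4 ^+ j) :> R.

Lemma exists_sound (R : realType) j S : exists x : word j, sound R S x.
Proof.
pose F (i : 'I_j.+1) (x : word j) : R :=
  if unpickle i is Some c then code_test c S x else 0.
pose b (i : 'I_j.+1) : R :=
  if unpickle i is Some c then (2 * code_card c)%:R * 4 ^+ j else 1.
have b0 i : 0 < b i.
  rewrite /b; case: unpickle => // c; rewrite mulr_gt0// ?exprn_gt0//.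
  by rewrite ltr0n muln_gt0 code_card_gt0.
have [x Hx] := exists_below_average [ffun=> false] F b0.
exists x => c i ij ci F0 Fb; have := Hx (Ordinal (ij : (i < j.+1)%N)).
by rewrite /F /b /= ci; apply.
Qed.

Lemma exists_sound_sequence (R : realType) :
  exists S, forall j, exists S' (x : word j), sound R S' x /\
    forall u, (u < start j.+1)%N -> S u = stage x S' u.
Proof. exact: stage_choice (@exists_sound R). Qed.

(** * Gain of an oblivious gambler on one stage *)

Section Oblivious.
Context {R : realType} {h : nat} (G : fsg R h).
Hypothesis Gobl : oblivious G.

Let d := @fsg_delta _ _ G.
Let b := @fsg_beta _ _ G.
Let q0 := fsg_q0 G.

Lemma head_at_pos S n i : head_at G S n i = pos d q0 n i.
Proof. by rewrite (Gobl S (fun=> false)). Qed.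

Lemma state_at_from S n : state_at G S n = state_from d q0 0 q0 S n.
Proof.
elim: n => // n IH; rewrite /= -IH /state_at /fsg_run iterS {1}/fsg_step.
case E : (fsg_delta _ _) => [q' r] /=.
have <- : [tuple S ((fsg_run G S n).2 i) | i < h] =
    [tuple S (pos d q0 (0 + n) i) | i < h].
  by apply: eq_from_tnth => k; rewrite !tnth_mktuple add0n -(head_at_pos S).
by rewrite /d /fsg_run E.
Qed.

Lemma capitalE S n : capital G S n = fsg_c0 G * gain d b q0 0 q0 S n.
Proof.
elim: n => [|n IH] /=; first by rewrite mulr1.
by rewrite IH add0n state_at_from [in RHS]mulrCA.
Qed.

Lemma avoids_fresh : exists j0, forall j, (j0 <= j)%N -> forall t i,
  (start j + 21 * j <= t < start j.+1)%N ->
  ~~ (start j <= pos d q0 t i < start j + 20 * j)%N.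
Proof.
have /choice[f Hf] := pos_avoids_fresh d q0.
exists (\max_i f i) => j hj t i; apply: Hf.
by apply: leq_trans hj; apply: leq_bigmax.
Qed.

(** The stage is cut into 20 j, j and 19 j bits. The test bounds both outer parts. The middle bets
    are conceded at a factor 2 each, which gives heads of bounded lag the time to leave the fresh
    half. *)
Lemma stage_gain_le S :
  (forall j, exists S' (x : word j), sound R S' x /\
    forall u, (u < start j.+1)%N -> S u = stage x S' u) ->
  exists j0, forall j q, (j0 <= j)%N ->
    gain d b q0 (start j) q S (40 * j) <=
    2 ^+ j * (j.+1%:R * ((2 * #|fsg_state G|)%:R * 4 ^+ j)) ^+ 2 :> R.
Proof.
move=> HS; have [j0 Hj0] := avoids_fresh.
exists (maxn j0 (pickle (encode G))) => j q; rewrite geq_max => /andP[j0j Gj].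
have [S' [x [snd Sx]]] := HS j.
have b0 := @fsg_beta_ge0 _ _ G; have b1 := @fsg_beta_sum1 _ _ G.
have Hx : test d b q0 S' x <=
    j.+1%:R * ((2 * #|fsg_state G|)%:R * 4 ^+ j) :> R.
  have := snd (encode G) _ Gj (pickleK _); rewrite code_test_encode; apply.
    by move=> y; rewrite code_test_encode test_ge0.
  under eq_bigr do rewrite code_test_encode.
  exact: sum_test.
set B := _ * (_ * _) in Hx *.
have term q' :
    gain d b q0 (start j) q' (stage x S') (20 * j) +
    gain d b q0 (start j + 21 * j) q' (mask j (stage x S')) (19 * j) <= B.
  apply: le_trans Hx; rewrite /test (bigD1 q')//= lerDl sumr_ge0// => q1 _.
  by rewrite addr_ge0 ?gain_ge0.
have g0 T q' X n : 0 <= gain d b q0 T q' X n :> R by exact: gain_ge0.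
have e40 : (40 * j = 20 * j + j + 19 * j)%N by lia.
rewrite e40 (gain_cat _ _ _ _ _ _ (20 * j + j)) (gain_cat _ _ _ _ _ _ (20 * j)) expr2.
have -> : (start j + (20 * j + j) = start j + 21 * j)%N by lia.
set q1 := state_from _ _ _ _ _ (20 * j); set q2 := state_from _ _ _ _ _ _.
rewrite -mulrA [leRHS]mulrCA.
apply: ler_pM; rewrite ?mulr_ge0//.
  rewrite (@eq_gain_lt _ _ _ _ _ _ _ _ S (stage x S')).
    by apply: le_trans (term q); rewrite lerDl.
  by move=> t tj; apply: Sx; rewrite startS; lia.
apply: ler_pM => //; first exact: gain_le.
apply: le_trans (term q2); rewrite -[leLHS]add0r lerD//.
rewrite (@eq_gain _ _ _ _ _ _ _ _ S (mask j (stage x S')))// => t tj.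
have tj' : (t < start j.+1)%N by rewrite startS; lia.
split=> [|i].
  rewrite Sx// /mask.
  by have -> : (start j <= t < start j + 20 * j)%N = false by apply/negP; lia.
have := Hj0 j j0j t i; rewrite /mask => ->; last by lia.
by apply: Sx; apply: leq_ltn_trans tj'; exact: pos_le.
Qed.

End Oblivious.

(** * The adaptive two-head gambler *)

Section Copying.
Variable S : nat -> bool.
Hypothesis HS : forall j, exists S' (x : word j),
  forall u, (u < start j.+1)%N -> S u = stage x S' u.

Lemma flag_at j g : (g < 2 * j)%N -> S (start j + 20 * g)%N = (g < j)%N.
Proof.
move=> gj; have [S' [x ->]] := HS j; last by rewrite startS; lia.
rewrite /stage ltnNge leq_addr ltn_add2l ltn_mul2l /=.
case: ltnP => jg; first by rewrite addKn /fresh dvdn_mulr.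
rewrite /replica; have -> : (start j + 20 * g - (start j + 20 * j) =
  20 * (g - j))%N by lia.
by rewrite dvdn_mulr.
Qed.

Lemma replica_at j t : (20 * j <= t < 40 * j)%N -> (0 < t %% 20)%N ->
  S (start j + t)%N = S (start j + t - 1 - 20 * j)%N.
Proof.
move=> tj t20; have [S' [x H]] := HS j; rewrite !H ?startS; try lia.
rewrite /stage.
do 4 (case: ltnP => ?; try by [lia]).
rewrite /replica; have -> : (20 %| start j + t - (start j + 20 * j))%N = false.
  by apply/negP; lia.
by congr (fresh x _); lia.
Qed.

Let copier_state : finType := ('I_20 * (bool * bool * bool))%type.

(* The state holds the offset in the current group of 20 bits, the last flag
   seen, whether the trailing head rests during this group, and the last bit
   under the trailing head. *)
Definition copier_delta (q : copier_state) (v : 2.-tuple bool) :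
    copier_state * 1.-tuple bool :=
  let: (r, (flag, rest, _)) := q in
  let lead := tnth v (@Ordinal 2 1 isT) in
  let flag' := if r == 0%N :> nat then lead else flag in
  let rest' := if r == 0%N :> nat then lead && ~~ flag else rest in
  ((ordS r, (flag', rest', tnth v (@Ordinal 2 0 isT))), [tuple ~~ rest']).

Definition copier_beta (q : copier_state) (b : bool) : rat :=
  let: (r, (flag, _, trail)) := q in
  if (0 < r)%N && ~~ flag then (b == trail)%:R else 1 / 2.

Lemma copier_beta_ge0 q b : 0 <= copier_beta q b.
Proof. by case: q => [r [[flag ?] ?]] /=; case: ifP => // _; case: eqP. Qed.

Lemma copier_beta_sum1 q : \sum_(b : bool) copier_beta q b = 1.
Proof.
case: q => [r [[flag ?] trail]]; rewrite big_bool /=.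
by case: ifP => // _; case: trail.
Qed.

Context {R : realType}.

Definition copier : fsg R 2 :=
  @Fsg R 2 copier_state copier_delta copier_beta copier_beta_ge0
    copier_beta_sum1 (ord0, (false, false, false)) 1 ler01.

(** Invariant at offset [r] of group [g] of stage [j]. The lag grows from [20 * j.-1] to [20 * j]
    during group 0. At [r = 0] the stored flag is still that of the previous group. *)
Lemma copier_run n j g r : (0 < j)%N -> (g < 2 * j)%N -> (r < 20)%N ->
  n = (start j + 20 * g + r)%N ->
  let: ((r', (flag, rest, trail)), hd) := fsg_run copier S n in
  [/\ r = r' :> nat,
      flag = (if r == 0%N then (0 < g <= j)%N else (g < j)%N),
      (0 < r)%N -> rest = (g == 0%N),
      hd (@Ordinal 2 0 isT) =
        (if g == 0%N then start j - 20 * j.-1 else n - 20 * j)%N /\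
      hd (@Ordinal 2 1 isT) = n &
      ((0 < r)%N -> (0 < g)%N -> trail = S (n - 1 - 20 * j)) /\
      capital copier S n = 2 ^+ (19 * 'C(j, 2) +
        (if g < j then 0 else 19 * (g - j) + r.-1))%N].
Proof.
elim: n j g r => [|n IH] j g r j0 gj r20 nE.
  have [j1 g0 r0] : [/\ j = 1, g = 0 & r = 0]%N.
    by have := double_bin2 j; rewrite /start in nE; split; nia.
  by subst.
have prev : exists j' g' r', [/\ (0 < j')%N, (g' < 2 * j')%N, (r' < 20)%N,
    n = (start j' + 20 * g' + r')%N &
    [\/ [/\ j = j', g = g' & r = r'.+1],
        [/\ j = j', g = g'.+1, r = 0%N & r' = 19%N] |
        [/\ j = j'.+1, g = 0%N, r = 0%N, r' = 19%N & g'.+1 = (2 * j')%N]]].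
  case: r r20 nE => [|r] r20 nE; last first.
    by exists j, g, r; split => //; [lia | lia | constructor 1].
  case: g gj nE => [|g] gj nE; last first.
    by exists j, g, 19%N; split => //; [lia | lia | constructor 2].
  case: j j0 gj nE => // j _ _; rewrite startS => nE.
  have j0 : (0 < j)%N by case: j nE.
  exists j, (2 * j).-1, 19%N; split => //; [lia | lia | constructor 3].
  by split => //; lia.
have [j' [g' [r' [j'0 g'j r'20 nE' next]]]] := prev.
have := IH _ _ _ j'0 g'j r'20 nE'; rewrite /fsg_run iterS.
rewrite [capital _ _ n.+1]/= /state_at /fsg_run.
case: (iter n _ _) => [[[k klt] [[flag rest] trail]] hd] /=.
move=> [kE flagE restE [hd0 hd1] [trailE capE]].
rewrite /fsg_step /= !tnth_mktuple /= hd1 hd0 {}capE -{k}kE in klt *.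
set flag' := if r' == 0%N then S n else flag.
set rest' := if r' == 0%N then S n && ~~ flag else rest.
have Sn0 : r' = 0%N -> S n = (g' < j')%N.
  by move=> r0; rewrite nE' r0 addn0 flag_at.
have flag'E : flag' = (g' < j')%N.
  by rewrite /flag' flagE; case: eqP.
have rest'E : rest' = (g' == 0%N).
  rewrite /rest' flagE; case: eqP => r0; last by rewrite restE// lt0n; apply/eqP.
  by rewrite Sn0//; clear -j'0; lia.
have half : 2 * ratr (1 / 2) = 1 :> R.
  by rewrite fmorph_div rmorph1 rmorph_nat mulrA mulr1 divff.
have -> : 2 * ratr (if (0 < r')%N && ~~ flag then (S n == trail)%:R else 1 / 2) =
    2 ^+ ((0 < r') && (j' <= g'))%N :> R.
  have [r0|r0] := posnP r'; first by rewrite /= half.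
  have -> : flag = (g' < j')%N by rewrite flagE -[r' == _]negbK -lt0n r0.
  rewrite -leqNgt /=.
  case: leqP => gj' /=; last by rewrite half.
  have -> : S n = S (n - 1 - 20 * j')%N.
    by rewrite nE' -addnA replica_at; clear -gj' r0 r'20 g'j; lia.
  by rewrite trailE ?eqxx ?rmorph1 ?mulr1//; clear -gj' j'0; lia.
rewrite -exprD flag'E rest'E; clearbody flag' rest'.
(* Keeps the truncated subtractions in the trailing position exact. *)
have sj : (20 * j' <= start j' + 20)%N.
  by have := double_bin2 j'; rewrite /start; nia.
clear -next j0 gj r20 nE nE' j'0 g'j r'20 sj.
case: next nE gj r20 => [[-> -> ->]|[-> -> -> ->]|[-> -> -> -> gE]] nE gj r20.
- rewrite !modn_small; last by lia.
  split => //; first (by rewrite addn1; split=> //; case: eqP => ? /=; lia).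
  split; first by move=> _ g0; rewrite ifF; [congr (S _); lia | apply/eqP; lia].
  by congr (2 ^+ _); case: (ltnP g' j') => ?; case: posnP => ? /=; lia.
- split => //; first (by rewrite addn1; split=> //; case: eqP => ? /=; lia).
  split=> //; congr (2 ^+ _).
  by case: (ltnP g' j') => ?; case: (ltnP g'.+1 j') => ? /=; lia.
- have := startS j'; have := double_bin2 j' => bE sE.
  split => //=; first by lia.
    by rewrite addn1; split=> //; case: eqP => ? /=; lia.
  by split=> //; congr (2 ^+ _); rewrite binS bin1 /=; case: (ltnP g' j') => ? /=; lia.
Qed.

End Copying.

Lemma stage_of n : exists j, (0 < j)%N /\ (start j <= n < start j.+1)%N.
Proof.
elim: n => [|n [j [j0 /andP[jn nj]]]]; first by exists 1%N.
have [lt|le] := ltnP n.+1 (start j.+1).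
  by exists j; rewrite j0 lt ltnW.
by exists j.+1; split => //; rewrite le startS; lia.
Qed.

(** With [i = j %/ 4], both [(i + 1) ^ 4 <= 2 ^ j] and [M * (j + 1) <= (i + 1) ^ 2]. *)
Lemma sqr_le_exp2 M j : (16 * M <= j)%N -> ((M * j.+1) ^ 2 <= 2 ^ j)%N.
Proof.
move=> Mj; pose i := (j %/ 4)%N.
have : ((i.+1 ^ 2) ^ 2 <= 2 ^ j)%N.
  apply: (@leq_trans (2 ^ (i * (2 * 2)))); last by rewrite leq_pexp2l// /i; lia.
  by rewrite -expnM [leqRHS]expnM leq_exp2r// ltn_expl.
apply: leq_trans; rewrite leq_exp2r// -mulnn.
have [h1 h2] : (4 * M <= i.+1)%N /\ (j.+1 <= 4 * i.+1)%N by rewrite /i; lia.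
apply: leq_trans (leq_mul (leqnn M) h2) _.
by rewrite mulnA (mulnC M) leq_mul2r h1 orbT.
Qed.

(** * Upper bound on the adaptive strong predimension *)

Section CopierSuccess.
Context {R : realType}.
Variable S : nat -> bool.
Hypothesis HS : forall j, exists S' (x : word j),
  forall u, (u < start j.+1)%N -> S u = stage x S' u.

Lemma copier_capital_ge n : exists j, (start j <= n < start j.+1)%N /\
  2 ^+ (19 * 'C(j, 2)) <= capital (@copier R) S n.
Proof.
have [j [j0 jn]] := stage_of n; exists j; split=> //.
move: jn; rewrite startS => jn.
have := copier_run HS (R := R) (g := (n - start j) %/ 20) (r := (n - start j) %% 20)
  (n := n) j0.
case: (fsg_run _ _ _) => [[r' [[? ?] ?]] hd].
case; [lia | lia | lia | move=> _ _ _ _ [_ ->]].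
by rewrite ler_eXn2l ?ltr1n// leq_addr.
Qed.

Lemma copier_strongly_succeeds :
  strongly_succeeds (@copier R) (53%:R / 100%:R) S.
Proof.
apply: (cvg_limn_einf_sup _).1; apply/cvgeryP/cvgryPge => A.
(* The exponent is at least [0.2 'C(j, 2) - 18.8 j], which is at least [j] once ['C(j, 2) >= 99 j],
   that is for [j >= 199]. *)
pose m := maxn 199 (Num.bound `|A|); exists (start m) => // n /= mn.
have [j [/andP[jn nj] cap]] := copier_capital_ge n.
have mj : (m <= j)%N.
  rewrite leqNgt; apply/negP => /start_homo h.
  by have := leq_ltn_trans mn (leq_trans nj h); rewrite ltnn.
apply: (@le_trans _ _ j%:R).
  apply: (@le_trans _ _ (Num.bound `|A|)%:R).
    by apply: le_trans (ler_norm A) _; exact/ltW/archi_boundP.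
  by rewrite ler_nat (leq_trans _ mj)// leq_maxr.
apply: (@le_trans _ _ (2 `^ j%:R)).
  by rewrite powR_mulrn// -natrX ler_nat ltnW// ltn_expl.
rewrite /sgale.
apply: (@le_trans _ _ (2 `^ ((53%:R / 100%:R - 1) * n%:R) *
    2 `^ (19 * 'C(j, 2))%:R)); last first.
  by rewrite ler_wpM2l ?powR_ge0// powR_mulrn.
rewrite -powRD ?pnatr_eq0 ?implybT//; apply: ler_powR; first by rewrite ler1n.
have hn : n%:R <= 40 * 'C(j, 2)%:R + 40 * j%:R :> R.
  by rewrite -!natrM -natrD ler_nat; move: nj; rewrite startS /start; lia.
have hc : 99 * j%:R <= 'C(j, 2)%:R :> R.
  rewrite -natrM ler_nat; have := double_bin2 j.
  have : (199 <= j)%N by apply: leq_trans mj; exact: leq_maxl.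
  by nia.
by rewrite natrM; lra.
Qed.

Lemma aDim_FS_le : (aDim_FS R 2 S <= (53%:R / 100%:R)%:E)%E.
Proof.
apply: ge_ereal_inf; exists (53%:R / 100%:R)%:E => //.
exists (53%:R / 100%:R) => //; split; first by rewrite divr_ge0.
by exists copier; exact: copier_strongly_succeeds.
Qed.

End CopierSuccess.

Lemma limn_esup_le_bound (R : realType) (u : nat -> \bar R) l :
  (forall n, u n <= l)%E -> (limn_esup u <= l)%E.
Proof.
move=> ul; apply: ge_ereal_inf; exists (ereal_sup (u @` setT)).
  by exists setT => //; exact: filterT.
by apply: ge_ereal_sup => _ [n _ <-].
Qed.

(** * Lower bound on the oblivious dimensions *)

Section ObliviousBound.
Context {R : realType}.
Variable S : nat -> bool.
Hypothesis HS : forall j, exists S' (x : word j), sound R S' x /\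
  forall u, (u < start j.+1)%N -> S u = stage x S' u.

(** [K] pays for the finitely many early stages and [40 * j] for the unfinished one; every other
    stage [i] contributes [6 * i]. *)
Lemma oblivious_capital_le h (G : fsg R h) : oblivious G ->
  exists K, forall n, exists j, (start j <= n)%N /\
    capital G S n <= fsg_c0 G * 2 ^+ (K + 6 * 'C(j, 2) + 40 * j).
Proof.
move=> Gobl; have [j0 Hj0] := stage_gain_le G HS.
set m := #|fsg_state G| in Hj0.
pose j1 := maxn j0 (16 * (2 * m)).
set d := @fsg_delta _ _ G in Hj0; set b := @fsg_beta _ _ G in Hj0.
set q0 := fsg_q0 G in Hj0.
have b0 := @fsg_beta_ge0 _ _ G; have b1 := @fsg_beta_sum1 _ _ G.
have stg j q : (j1 <= j)%N ->
    gain d b q0 (start j) q S (40 * j) <= 2 ^+ (6 * j) :> R.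
  rewrite geq_max => /andP[j0j mj]; apply: le_trans (Hj0 _ _ j0j) _.
  (* One [2 ^+ j] for the conceded bets, one to absorb the squared polynomial factor, and [4 ^+ j]
     for each tested part. *)
  have -> : 2 ^+ (6 * j) = 2 ^+ j * (2 ^+ j * (4 ^+ j) ^+ 2) :> R.
    by rewrite -[4]/((2 * 2)%:R) natrM -expr2 -!exprM -!exprD; congr (_ ^+ _); lia.
  rewrite ler_wpM2l ?exprn_ge0// mulrA exprMn ler_wpM2r ?exprn_ge0//.
  by rewrite -natrM -!natrX ler_nat mulnC sqr_le_exp2.
have bnd j : (j1 <= j)%N ->
    gain d b q0 0 q0 S (start j) <= 2 ^+ (start j1 + 6 * 'C(j, 2)) :> R.
  move=> /subnKC <-; elim: (j - j1)%N => [|i IH].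
    rewrite addn0; apply: le_trans (gain_le _ _ b0 b1 _ _ _ _) _.
    by rewrite ler_weXn2l ?ler1n// leq_addr.
  rewrite addnS; move: (leq_addr i j1) IH; move: (j1 + i)%N => k j1k IH.
  rewrite startS gain_cat add0n binS bin1 mulnDr addnA exprD.
  by apply: ler_pM; rewrite ?gain_ge0// stg.
exists (start j1) => n; have [j [_ /andP[jn nj]]] := stage_of n.
exists j; split=> //; rewrite (capitalE Gobl) ler_wpM2l ?fsg_c0_ge0//.
have [j1j|jj1] := leqP j1 j.
  rewrite -(subnKC jn) gain_cat exprD.
  apply: ler_pM; rewrite ?gain_ge0 ?bnd//.
  apply: le_trans (gain_le _ _ b0 b1 _ _ _ _) _.
  by rewrite ler_weXn2l ?ler1n//; move: nj; rewrite startS; lia.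
apply: le_trans (gain_le _ _ b0 b1 _ _ _ _) _.
rewrite ler_weXn2l ?ler1n//.
by have := start_homo jj1; lia.
Qed.

Lemma oblivious_not_succeeds h (G : fsg R h) s : oblivious G ->
  s < 85%:R / 100%:R -> ~ succeeds G s S.
Proof.
move=> Gobl s85; have [K HK] := oblivious_capital_le Gobl.
set e := 85%:R / 100%:R - s; have e0 : 0 < e by rewrite subr_gt0.
(* As 40 (1 - 0.85) = 6, the exponent is at most [K + 40 (j - e 'C(j, 2))], and the bracket is
   nonpositive once [j >= 2 / e + 1]. *)
pose B : R := K%:R + 40 * (2 / e + 1).
suff : (limn_esup (fun n => (sgale G s S n)%:E) <= (fsg_c0 G * 2 `^ B)%:E)%E.
  by rewrite /succeeds => + E; rewrite E.
apply: limn_esup_le_bound => n; rewrite lee_fin /sgale.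
have [j [jn cap]] := HK n.
apply: le_trans (ler_wpM2l (powR_ge0 _ _) cap) _.
rewrite mulrCA ler_wpM2l ?fsg_c0_ge0// -powR_mulrn//.
rewrite -powRD ?pnatr_eq0 ?implybT//; apply: ler_powR; first by rewrite ler1n.
have hn : 40 * 'C(j, 2)%:R <= n%:R :> R by rewrite -natrM ler_nat.
have hC : 'C(j, 2)%:R + 'C(j, 2)%:R + j%:R = j%:R * j%:R :> R.
  by rewrite -natrM -!natrD double_bin2.
have sn : (s - 1) * n%:R <= (s - 1) * (40 * 'C(j, 2)%:R).
  by rewrite ler_wnM2l// /e in e0 *; lra.
have key : j%:R - e * 'C(j, 2)%:R <= 2 / e + 1.
  have [small|big] := lerP (j%:R : R) (2 / e + 1).
    apply: le_trans small; rewrite gerBl mulr_ge0// ltW//.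
  have big' : 2 <= e * (j%:R - 1).
    by rewrite mulrC -ler_pdivrMr//; lra.
  have : j%:R * 2 <= j%:R * (e * (j%:R - 1)) by rewrite ler_wpM2l.
  have : 0 < 2 / e by rewrite divr_gt0.
  by nra.
have -> : (K + 6 * 'C(j, 2) + 40 * j)%:R =
    K%:R + 6 * 'C(j, 2)%:R + 40 * j%:R :> R by rewrite -!natrM -!natrD.
rewrite /B; move: (2 / e) key => t; rewrite /e => key.
by clear e e0 B; lra.
Qed.

Lemma odim_FS_ge h : ((85%:R / 100%:R)%:E <= odim_FS R h S)%E.
Proof.
apply: le_ereal_inf_tmp => _ [s [_ [G [Gobl succ]]] <-].
rewrite lee_fin leNgt; apply/negP => s85.
exact: oblivious_not_succeeds succ.
Qed.

Lemma odim_FS_MH_ge : ((85%:R / 100%:R)%:E <= odim_FS_MH R S)%E.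
Proof.
rewrite /odim_FS_MH /limn_einf leeNr; apply: limn_esup_le_bound => h.
by rewrite leeN2 odim_FS_ge.
Qed.

End ObliviousBound.

Theorem theorem7p1 (R : realType) :
  exists S : nat -> bool,
    (aDim_FS R 2 S < odim_FS_MH R S - (3%:R / 10%:R)%R%:E)%E.
Proof.
have [S HS] := exists_sound_sequence R; exists S.
have HS' j : exists S' (x : word j),
    forall u, (u < start j.+1)%N -> S u = stage x S' u.
  by have [S' [x [_ Sx]]] := HS j; exists S', x.
apply: le_lt_trans (aDim_FS_le HS') _.
(* What remains is 0.53 + 0.3 < 0.85. *)
rewrite lteBrDr//; apply: lt_le_trans (odim_FS_MH_ge HS).
by rewrite -EFinD lte_fin; lra.
Qed.
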